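(* The assignment $G\mapsto \mathrm{MH}_{*,*}(G)$, $f\mapsto f_*$ is a functor from the category of graphs (with maps of graphs as morphisms) to the category of bigraded abelian groups.
   Context: A graph is a finite undirected graph with no loops or multiple edges. $d(x,y)$ is the length of a shortest edge path from $x$ to $y$ ($\infty$ if in different components). The length of a tuple of vertices is $\ell(x_0,\dots,x_k)=\sum_{i=1}^{k} d(x_{i-1},x_i)$. $\mathrm{MC}_{k,l}(G)$ ($k,l\ge0$) is the free abelian group on tuples $(x_0,\dots,x_k)$ of vertices with consecutive entries distinct and $\ell(x_0,\dots,x_k)=l$. The differential $\partial\colon \mathrm{MC}_{k,l}(G)\to\mathrm{MC}_{k-1,l}(G)$ is $\partial=\sum_{i=1}^{k-1}(-1)^i\partial_i$, where $\partial_i$ omits the $i$-th entry $x_i$ if the resulting tuple still has length $l$, and is $0$ otherwise. $\mathrm{MH}_{k,l}(G)=H_k(\mathrm{MC}_{*,l}(G))$. A map of graphs $f\colon G\to H$ is a map of vertex sets $f\colon V(G)\to V(H)$ such that $\{x,y\}\in E(G)$ implies $\{f(x),f(y)\}\in E(H)$ or $f(x)=f(y)$. The induced chain map $f_\#\colon\mathrm{MC}_{*,*}(G)\to\mathrm{MC}_{*,*}(H)$ sends a generator $(x_0,\dots,x_k)$ to $(f(x_0),\dots,f(x_k))$ if $\ell(f(x_0),\dots,f(x_k))=\ell(x_0,\dots,x_k)$, and to $0$ otherwise; $f_*\colon\mathrm{MH}_{*,*}(G)\to\mathrm{MH}_{*,*}(H)$ is the map induced by $f_\#$ in homology. *)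

(* Defs.v *)
From HB Require Import structures.
From mathcomp Require Import all_boot all_order all_algebra.
From mathcomp Require Import boolp.
From mathcomp Require Import zify.
From mathcomp.multinomials Require Import freeg.

Set Implicit Arguments.
Unset Strict Implicit.
Unset Printing Implicit Defensive.

Import GRing.Theory.

Record category := Category {
  obj :> Type;
  hom : obj -> obj -> Type;
  idmap : forall A, hom A A;
  compmap : forall A B C, hom B C -> hom A B -> hom A C;
  compmap1l : forall A B (f : hom A B), compmap (idmap B) f = f;
  compmap1r : forall A B (f : hom A B), compmap f (idmap A) = f;
  compmapA : forall A B C D (h : hom C D) (g : hom B C) (f : hom A B),
    compmap h (compmap g f) = compmap (compmap h g) f
}.

Arguments idmap {c} A.
Arguments compmap {c A B C} g f : rename.

Record is_functor (C D : category) (F0 : C -> D)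
    (F1 : forall A B : C, hom A B -> hom (F0 A) (F0 B)) : Prop := IsFunctor {
  functor_id : forall A : C, F1 A A (idmap A) = idmap (F0 A);
  functor_comp : forall (A B E : C) (g : hom B E) (f : hom A B),
    F1 A E (compmap g f) = compmap (F1 B E g) (F1 A B f)
}.

Record graph := Graph {
  vertex :> finType;
  edge : rel vertex;
  edge_sym : symmetric edge;
  edge_irr : irreflexive edge
}.

Record graph_map (G H : graph) := GraphMap {
  graph_fun :> G -> H;
  graph_mapP : forall x y : G,
    edge x y -> edge (graph_fun x) (graph_fun y) \/ graph_fun x = graph_fun y
}.

Lemma graph_map_eq (G H : graph) (f g : graph_map G H) : f =1 g -> f = g.
Proof.
case: f g => [f fP] [g gP] /= /funext fg; subst g.
by rewrite (Prop_irrelevance fP gP).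
Qed.

Lemma graph_id_proof (G : graph) (x y : G) :
  edge x y -> edge (id x) (id y) \/ id x = id y.
Proof. by left. Qed.

Definition graph_id (G : graph) : graph_map G G :=
  GraphMap (@graph_id_proof G).

Lemma graph_comp_proof (G H K : graph) (g : graph_map H K) (f : graph_map G H)
    (x y : G) :
  edge x y -> edge ((g \o f) x) ((g \o f) y) \/ (g \o f) x = (g \o f) y.
Proof.
by case/(graph_mapP f) => [/(graph_mapP g)|/= ->] //; right.
Qed.

Definition graph_comp (G H K : graph) (g : graph_map H K) (f : graph_map G H) :
  graph_map G K := GraphMap (@graph_comp_proof G H K g f).

Program Definition graph_category : category := {|
  obj := graph;
  hom := graph_map;
  idmap := graph_id;
  compmap := graph_comp
|}.
Next Obligation. by apply: graph_map_eq. Qed.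
Next Obligation. by apply: graph_map_eq. Qed.
Next Obligation. by apply: graph_map_eq. Qed.

Local Open Scope ring_scope.

Definition bigraded := nat -> nat -> zmodType.

Definition bigraded_map (A B : bigraded) :=
  forall k l, {additive A k l -> B k l}.

Lemma additive_eq (U V : zmodType) (f g : {additive U -> V}) : f =1 g -> f = g.
Proof.
case: f g => [f [[f1]]] [g [[g1]]] /= /funext fg; subst g.
by rewrite (Prop_irrelevance f1 g1).
Qed.

Lemma bigraded_map_eq (A B : bigraded) (f g : bigraded_map A B) :
  (forall k l, f k l =1 g k l) -> f = g.
Proof.
move=> fg; apply: functional_extensionality_dep => k.
by apply: functional_extensionality_dep => l; apply: additive_eq.
Qed.

Definition bigraded_id (A : bigraded) : bigraded_map A A :=
  fun k l => idfun : {additive A k l -> A k l}.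

Definition bigraded_comp (A B C : bigraded)
    (g : bigraded_map B C) (f : bigraded_map A B) : bigraded_map A C :=
  fun k l => (g k l \o f k l : {additive A k l -> C k l}).

Program Definition bigraded_category : category := {|
  obj := bigraded;
  hom := bigraded_map;
  idmap := bigraded_id;
  compmap := bigraded_comp
|}.
Next Obligation. by apply: bigraded_map_eq. Qed.
Next Obligation. by apply: bigraded_map_eq. Qed.
Next Obligation. by apply: bigraded_map_eq. Qed.

Record chain_complex := ChainComplex {
  chain :> nat -> zmodType;
  bd : forall k, {additive chain k.+1 -> chain k};
  bdK : forall k (c : chain k.+2), bd k (bd k.+1 c) = 0
}.

Record chain_map (C D : chain_complex) := ChainMap {
  chain_fun :> forall k, {additive C k -> D k};
  chain_mapP : forall k (c : C k.+1),
    chain_fun k (bd C k c) = bd D k (chain_fun k.+1 c)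
}.

Section Homology.
Variable C : chain_complex.

(* Complexes are concentrated in nonnegative degrees: every 0-chain is a
   cycle. *)
Definition is_cycle (k : nat) : C k -> bool :=
  if k is k'.+1 then fun c => bd C k' c == 0 else fun=> true.

Lemma is_cycle_closed k : zmod_closed (@is_cycle k).
Proof.
case: k => [|k]; split=> //; first by rewrite unfold_in /= raddf0.
by move=> x y; rewrite !unfold_in /= raddfB => /eqP -> /eqP ->; rewrite subrr.
Qed.

HB.instance Definition _ k :=
  GRing.isZmodClosed.Build (C k) (@is_cycle k) (is_cycle_closed k).

Record cycles (k : nat) := Cycle {
  cycle_val : C k;
  cycleP : cycle_val \in @is_cycle k
}.

HB.instance Definition _ k := [isSub for @cycle_val k].
HB.instance Definition _ k := [Choice of cycles k by <:].
HB.instance Definition _ k := [SubChoice_isSubZmodule of cycles k by <:].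

Definition is_boundary (k : nat) : cycles k -> bool :=
  fun z => `[< exists c : C k.+1, bd C k c = val z >].

Lemma is_boundary_closed k : zmod_closed (@is_boundary k).
Proof.
split=> [|x y /asboolP[a ax] /asboolP[b bY]]; apply/asboolP.
  by exists 0; rewrite !raddf0.
by exists (a - b); rewrite !raddfB /= ax bY.
Qed.

HB.instance Definition _ k :=
  GRing.isZmodClosed.Build (cycles k) (@is_boundary k) (is_boundary_closed k).

Definition boundaries (k : nat) : zmodClosed (cycles k) :=
  GRing.ZmodClosed.clone (cycles k) (@is_boundary k) _.

Definition homology (k : nat) : zmodType := Quotient.quot (boundaries k).

Definition homology_class k (z : cycles k) : homology k :=
  (\pi_(Quotient.quot (boundaries k)) z)%qT.

End Homology.

Section HomologyMap.
Variables (C D : chain_complex) (f : chain_map C D).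

Lemma cycles_map_proof k (z : cycles C k) : f k (val z) \in @is_cycle D k.
Proof.
case: k z => [|k] [z zP] //=; move: zP; rewrite !unfold_in /= => /eqP zP.
by rewrite -chain_mapP zP raddf0.
Qed.

Definition cycles_map k (z : cycles C k) : cycles D k :=
  Cycle (cycles_map_proof z).

Definition homology_fun k (h : homology C k) : homology D k :=
  homology_class (cycles_map (repr h)).

Lemma homology_funE k (z : cycles C k) :
  homology_fun (homology_class z) = homology_class (cycles_map z).
Proof.
rewrite /homology_fun /homology_class; set y := repr _.
have: (y == z %[mod Quotient.quot (boundaries C k)])%qT.
  by apply/eqP; rewrite reprK.
rewrite -Quotient.idealrBE => /asboolP[c cE]; apply/eqP.
rewrite -Quotient.idealrBE; apply/asboolP; exists (f k.+1 c).
by rewrite -chain_mapP cE !raddfB.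
Qed.

Lemma homology_classB (E : chain_complex) k (x y : cycles E k) :
  homology_class (x - y) = homology_class x - homology_class y.
Proof. exact: raddfB. Qed.

Lemma homology_fun_additive k : zmod_morphism (@homology_fun k).
Proof.
have cls (x : homology C k) : {z | x = homology_class z}.
  by exists (repr x); rewrite /homology_class reprK.
move=> x y; have [[z ->] [w ->]] := (cls x, cls y).
rewrite -homology_classB !homology_funE -homology_classB.
by congr homology_class; apply: val_inj; rewrite /= !raddfB.
Qed.

HB.instance Definition _ k := GRing.isZmodMorphism.Build
  (homology C k) (homology D k) (@homology_fun k) (@homology_fun_additive k).

Definition homology_map k : {additive homology C k -> homology D k} :=
  @homology_fun k.

End HomologyMap.

(* Extended natural numbers: [None] stands for infinity. *)
Definition oaddn (a b : option nat) : option nat :=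
  if (a, b) is (Some m, Some n) then Some (m + n)%N else None.

Definition oleq (a b : option nat) : bool :=
  match a, b with
  | _, None => true
  | None, Some _ => false
  | Some m, Some n => (m <= n)%N
  end.

Lemma oleq_trans b a c : oleq a b -> oleq b c -> oleq a c.
Proof. by case: a b c => [a|] [b|] [c|] //=; exact: leq_trans. Qed.

Lemma oleq_refl a : oleq a a.
Proof. by case: a => /=. Qed.

Lemma oleq_add a b c d : oleq a b -> oleq c d -> oleq (oaddn a c) (oaddn b d).
Proof. by case: a b c d => [a|] [b|] [c|] [d|] //=; exact: leq_add. Qed.

(* Additive maps out of a free abelian group are determined by the basis. *)
Lemma freeg_additive_eq (K : choiceType) (V : zmodType)
    (f g : {additive {freeg K / int} -> V}) :
  (forall x, f << x >> = g << x >>) -> f =1 g.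
Proof.
move=> fg c; rewrite -[c]freeg_sumE !raddf_sum; apply: eq_bigr => x _.
by rewrite -[coeff x c]intz -freegU_mulz !raddfMz fg.
Qed.

Section Distance.
Variable G : graph.

Definition walk (n : nat) (x y : G) : bool :=
  [exists p : n.-tuple G, path (@edge G) x p && (last x p == y)].

Lemma walkP n x y :
  reflect (exists p : seq G, [/\ size p = n, path (@edge G) x p & last x p = y])
          (walk n x y).
Proof.
apply: (iffP existsP) => [[p /andP[pP /eqP pE]]|[p [pS pP pE]]].
  by exists p; rewrite size_tuple.
by exists (Tuple (introT eqP pS)); rewrite /= pP pE eqxx.
Qed.

Definition dist (x y : G) : option nat :=
  if pselect (exists n, walk n x y) is left xy then Some (ex_minn xy) else None.

Definition path_length (x : G) (p : seq G) : option nat :=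
  foldr oaddn (Some 0%N) (pairmap dist x p).

Definition tuple_length (s : seq G) : option nat :=
  if s is x :: p then path_length x p else Some 0%N.

Lemma path_length_cons x y p :
  path_length x (y :: p) = oaddn (dist x y) (path_length y p).
Proof. by []. Qed.

Lemma dist_walk x y n : dist x y = Some n -> walk n x y.
Proof. by rewrite /dist; case: pselect => // xy [<-]; case: ex_minnP. Qed.

Lemma walk_dist x y n : walk n x y -> oleq (dist x y) (Some n).
Proof.
move=> w; rewrite /dist; case: pselect => [xy|[]]; last by exists n.
by case: ex_minnP => m _ /(_ _ w).
Qed.

Lemma distxx x : dist x x = Some 0%N.
Proof.
have: walk 0 x x by apply/walkP; exists [::].
by move/walk_dist; case: dist => [[]|].
Qed.

Lemma dist_eq0 x y : dist x y = Some 0%N -> x = y.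
Proof. by move/dist_walk/walkP => [[|? ?]] [] // _ _. Qed.

Lemma dist_triangle y x z : oleq (dist x z) (oaddn (dist x y) (dist y z)).
Proof.
case xy: (dist x y) => [m|]; last by case: dist.
case yz: (dist y z) => [n|]; last by case: dist.
have /walkP[p [<- pP pE]] := dist_walk xy.
have /walkP[q [<- qP qE]] := dist_walk yz.
apply: walk_dist; apply/walkP; exists (p ++ q).
by rewrite size_cat cat_path last_cat pE pP qP qE.
Qed.

(* Tuples (x_0, ..., x_k) are sequences of size k + 1. *)
Definition is_generator (k l : nat) (s : seq G) : bool :=
  [&& size s == k.+1, sorted (fun x y => x != y) s & tuple_length s == Some l].

Definition generator (k l : nat) := {s : seq G | is_generator k l s}.

Definition MC (k l : nat) : lmodType int := {freeg (generator k l) / int}.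

(* The basis element given by [s], or 0 if [s] is not a generator. *)
Definition basis (k l : nat) (s : seq G) : MC k l :=
  if insub s : option (generator k l) is Some x then << x >> else 0.

Definition del (i : nat) (s : seq G) : seq G := take i s ++ drop i.+1 s.

(* Boundary of a generator s = (x_0, ..., x_{k+1}) of degree k + 1. [basis] tests
   whether [del i s] is a generator, which for 0 < i <= k amounts to testing
   whether its length is still l; see [is_generator_del]. *)
Definition bd_generator (k l : nat) (s : seq G) : MC k l :=
  \sum_(1 <= i < k.+1) (-1) ^+ i *: basis k l (del i s).

Definition bd_MC (k l : nat) : MC k.+1 l -> MC k l :=
  fglift (fun s : generator k.+1 l => bd_generator k l (val s)).

HB.instance Definition _ k l :=
  GRing.isZmodMorphism.Build (MC k.+1 l) (MC k l) (@bd_MC k l)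
    (lift_is_additive _).

Lemma path_length_del_le i x p : oleq (path_length x (del i p)) (path_length x p).
Proof.
elim: i x p => [|i IH] x [|y p] //=; last first.
  rewrite -/(del i p) !path_length_cons.
  exact: oleq_add (oleq_refl _) (IH _ _).
rewrite /del /= drop0 path_length_cons.
case: p => [|z p]; first by rewrite {1}/path_length /=; case: oaddn.
rewrite !path_length_cons.
move: (dist_triangle y x z); move: (path_length z p).
case: (dist x z) (dist x y) (dist y z) => [a|] [b|] [c|] [d|] //=.
by rewrite addnA leq_add2r.
Qed.

Lemma tuple_length_del i s : oleq (tuple_length (del i s)) (tuple_length s).
Proof.
case: s i => [|x p] [|i] //=; last exact: path_length_del_le.
rewrite /del /= drop0; case: p => [|y p] //=; rewrite path_length_cons.
by case: path_length => [a|]; case: dist => //= b; rewrite leq_addl.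
Qed.

Lemma path_del i x p l : (i.+1 < size p)%N ->
  path (fun x y => x != y) x p -> path_length x p = Some l ->
  path_length x (del i p) = Some l -> path (fun x y => x != y) x (del i p).
Proof.
elim: i x p l => [|i IH] x [|y p] // l.
  rewrite /del /= drop0; case: p => [|z p] //= _ /and3P[xy yz ->].
  rewrite andbT !path_length_cons => e1 e2; apply: contraNneq xy => xz.
  move: e1 e2; rewrite {}xz distxx.
  case yE: (dist z y) => [a|] //=; case: (dist y z) => [b|] //=.
  case: path_length => //= c [<-] [e].
  have a0 : a = 0%N by lia.
  by move: yE; rewrite a0 => /dist_eq0 ->.
rewrite [del _ _]/= -/(del i p) !path_length_cons /= ltnS => ip /andP[-> yp] /=.
move: (IH y p); case: dist => //= a.
case: path_length => //= b /(_ b ip yp erefl) H [<-] e; apply: H.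
by move: e; case: path_length => //= c [/addnI ->].
Qed.

Lemma size_del i s : (i < size s)%N -> size (del i s) = (size s).-1.
Proof.
by move=> i_s; rewrite size_cat size_takel ?(ltnW i_s) // size_drop; lia.
Qed.

Lemma is_generator_del k l s i : is_generator k.+1 l s -> (0 < i < k.+1)%N ->
  is_generator k l (del i s) = (tuple_length (del i s) == Some l).
Proof.
case/and3P => /eqP sS s_neq /eqP sl ik; rewrite /is_generator.
rewrite size_del sS ?eqxx /=; last by lia.
case: eqP; rewrite (andbF, andbT) // => dl.
case: s i ik sS s_neq sl dl => [|x p] [|i] //= ip [pS].
by move=> px pl dl; apply: path_del pl dl => //; rewrite pS.
Qed.

Lemma del_del i j s : (i <= j)%N -> del j (del i s) = del i (del j.+1 s).
Proof.
elim: s i j => [|x s IH] [|i] [|j] //= ij; first by rewrite /del /= !drop0.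
  by rewrite /del /= !drop0.
by rewrite -[LHS]/(x :: del j (del i s)) IH.
Qed.

Lemma basis_val k l (x : generator k l) : basis k l (val x) = << x >>.
Proof. by rewrite /basis valK. Qed.

Lemma basis0 k l s : ~~ is_generator k l s -> basis k l s = 0.
Proof. by move=> sP; rewrite /basis insubN. Qed.

Lemma bd_basis k l s : is_generator k.+1 l s ->
  bd_MC (basis k.+1 l s) = bd_generator k l s.
Proof.
by move=> sP; rewrite /basis insubT /bd_MC liftU scale1r.
Qed.

Lemma bd_basis_del k l s i : is_generator k.+2 l s -> (0 < i < k.+2)%N ->
  bd_MC (basis k.+1 l (del i s)) = bd_generator k l (del i s).
Proof.
move=> sP ik; case dP: (is_generator k.+1 l (del i s)); first exact: bd_basis.
rewrite basis0 ?dP // raddf0 /bd_generator big1 // => j _.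
rewrite basis0 ?scaler0 //; apply: contraFN dP => /and3P[_ _ /eqP jl].
rewrite is_generator_del //.
have /and3P[_ _ /eqP sl] := sP.
move: (tuple_length_del i s) (tuple_length_del j (del i s)).
rewrite sl jl; case: tuple_length => //= m ml lm.
by apply/eqP; congr Some; lia.
Qed.

Lemma alternating_sum (V : zmodType) (T : nat -> nat -> V) n :
  (forall i j, (i <= j)%N -> T i j = - T j.+1 i) ->
  \sum_(1 <= i < n.+1) \sum_(1 <= j < n) T i j = 0.
Proof.
move=> TN; elim: n => [|n IH]; first by rewrite big_nil.
case: n IH => [|n] IH; first by rewrite big1 // => i _; rewrite big_nil.
rewrite big_nat_recr //=.
under eq_bigr do rewrite big_nat_recr //=.
rewrite big_split /= IH add0r -big_split /= big_nat big1 // => i /andP[_ ni].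
by rewrite TN ?addNr.
Qed.

Lemma bd_MCK k l (c : MC k.+2 l) : bd_MC (bd_MC c) = 0.
Proof.
pose d0 : {additive MC k.+2 l -> MC k l} := @bd_MC k l \o @bd_MC k.+1 l.
pose z0 : {additive MC k.+2 l -> MC k l} := \0.
apply: (@freeg_additive_eq _ _ d0 z0) => x; rewrite /d0 /z0 /= -basis_val.
have xP := valP x; rewrite bd_basis // raddf_sum /=.
under eq_big_nat => i ik do rewrite raddfZsign /= bd_basis_del // scaler_sumr.
apply: alternating_sum => i j ij; rewrite !scalerA del_del //.
by rewrite [in RHS]exprS mulN1r mulNr scaleNr opprK mulrC.
Qed.

Definition magnitude_complex (l : nat) : chain_complex := {|
  chain := fun k => MC k l;
  bd := fun k => @bd_MC k l;
  bdK := fun k => @bd_MCK k l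
|}.

End Distance.

Section InducedMap.
Variables (G H : graph) (f : graph_map G H).

(* As in [bd_generator], the test made by [basis] amounts to whether the length
   of the image is still l; see [is_generator_map]. *)
Definition MC_map (k l : nat) : MC G k l -> MC H k l :=
  fglift (fun s : generator G k l => basis k l (map f (val s))).

HB.instance Definition _ k l :=
  GRing.isZmodMorphism.Build (MC G k l) (MC H k l) (@MC_map k l)
    (lift_is_additive _).

Lemma dist_map x y : oleq (dist (f x) (f y)) (dist x y).
Proof.
case xy: (dist x y) => [n|]; last by case: dist.
have /walkP[p [<- pP <-]] := dist_walk xy; elim: p x {xy} pP => [|z p IH] x /=.
  by rewrite distxx.
case/andP => xz /IH zp; apply: oleq_trans (dist_triangle (f z) _ _) _.
rewrite -[Some _]/(oaddn (Some 1%N) (Some (size p))).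
apply: oleq_add zp; case: (graph_mapP f xz) => [e|->]; last by rewrite distxx.
by apply: walk_dist; apply/walkP; exists [:: f z]; rewrite /= e.
Qed.

Lemma path_length_map x p :
  oleq (path_length (f x) (map f p)) (path_length x p).
Proof.
elim: p x => [|y p IH] x //=; rewrite !path_length_cons.
exact: oleq_add (dist_map _ _) (IH _).
Qed.

Lemma tuple_length_map s : oleq (tuple_length (map f s)) (tuple_length s).
Proof. by case: s => //= x p; exact: path_length_map. Qed.

Lemma path_map_neq x p l : path (fun x y => x != y) x p ->
  path_length x p = Some l -> path_length (f x) (map f p) = Some l ->
  path (fun x y => x != y) (f x) (map f p).
Proof.
elim: p x l => [|y p IH] x l //= /andP[xy yp]; rewrite !path_length_cons.
move: (dist_map x y) (path_length_map y p) (IH y).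
case xyE: (dist x y) => [a|] //; case: (path_length y p) => [b|] //=.
case fxyE: (dist (f x) (f y)) => [a'|] //=.
case: path_length => //= b' aa bb /(_ b yp erefl) {}IH [<-] [e].
have [aE bE] : a' = a /\ b' = b by lia.
rewrite {}IH ?bE // andbT; apply: contraNneq xy => fxy.
move: fxyE xyE; rewrite fxy distxx aE => -[<-] /dist_eq0 ->.
exact: eqxx.
Qed.

Lemma is_generator_map k l s : is_generator k l s ->
  is_generator k l (map f s) = (tuple_length (map f s) == Some l).
Proof.
case/and3P => sS s_neq /eqP sl; rewrite /is_generator size_map sS /=.
case: eqP; rewrite (andbF, andbT) // => fl.
by case: s {sS} s_neq sl fl => //= x p; exact: path_map_neq.
Qed.

Lemma map_del i s : map f (del i s) = del i (map f s).
Proof. by rewrite /del map_cat map_take map_drop. Qed.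

Lemma MC_map_basis k l s : is_generator k l s ->
  MC_map (basis k l s) = basis k l (map f s).
Proof. by move=> sP; rewrite /basis insubT /MC_map liftU scale1r. Qed.

Lemma MC_map_bd k l (c : MC G k.+1 l) : MC_map (bd_MC c) = bd_MC (MC_map c).
Proof.
pose df : {additive MC G k.+1 l -> MC H k l} := @MC_map k l \o @bd_MC G k l.
pose fd : {additive MC G k.+1 l -> MC H k l} := @bd_MC H k l \o @MC_map k.+1 l.
apply: (@freeg_additive_eq _ _ df fd) => x; rewrite /df /fd /= -basis_val.
have := valP x; move: (val x) => s sP; rewrite bd_basis // MC_map_basis //.
have /and3P[_ _ /eqP sl] := sP.
rewrite raddf_sum /=.
transitivity (bd_generator k l (map f s)).
  apply: eq_big_nat => i ik; rewrite raddfZsign /=; congr (_ *: _).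
  case dP: (is_generator k l (del i s)); first by rewrite MC_map_basis // map_del.
  rewrite basis0 ?dP // raddf0 basis0 // -map_del.
  apply: contraFN dP => /and3P[_ _ /eqP fl]; rewrite is_generator_del //.
  move: (tuple_length_map (del i s)) (tuple_length_del i s).
  rewrite fl sl; case: tuple_length => //= m lm ml.
  by apply/eqP; congr Some; lia.
case fP: (is_generator k.+1 l (map f s)); first by rewrite bd_basis.
rewrite basis0 ?fP // raddf0 /bd_generator big1 // => i _.
rewrite basis0 ?scaler0 //; apply: contraFN fP => /and3P[_ _ /eqP dl].
rewrite is_generator_map //.
move: (tuple_length_map s) (tuple_length_del i (map f s)).
rewrite dl sl; case: tuple_length => //= m lm ml.
by apply/eqP; congr Some; lia.
Qed.

Definition magnitude_chain_map (l : nat) :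
    chain_map (magnitude_complex G l) (magnitude_complex H l) :=
  @ChainMap (magnitude_complex G l) (magnitude_complex H l)
    (fun k => @MC_map k l) (fun k => @MC_map_bd k l).

End InducedMap.

Definition MH (G : graph) : bigraded :=
  fun k l => homology (magnitude_complex G l) k.

Definition MH_map (G H : graph) (f : graph_map G H) :
    bigraded_map (MH G) (MH H) :=
  fun k l => homology_map (magnitude_chain_map f l) k.

(* Main.v *)
Require Import Defs.
From mathcomp Require Import all_boot all_algebra.
From mathcomp.multinomials Require Import freeg.
From mathcomp Require Import zify.

(** The construction of [f_*] from [f] factors through chain maps, and homology
    respects identities and composites because a homology class is represented
    by a cycle. So everything reduces to two identities between chain maps,
    [id_# = id] and [(g \o f)_# = g_# \o f_#], and these may be checked on
    generators, where only the vanishing rule needs an argument. If the image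
    [f s] of a generator [s] is shorter than [s], then [f_# s = 0]; maps of
    graphs never lengthen tuples ([tuple_length_map]), so [g (f s)] is then also
    shorter than [s], and [(g \o f)_# s = 0] as well ([generator_map_inv]).
    Otherwise [f s] is a generator of the same bidegree and both sides are the
    basis element of [g (f s)], or 0 if that tuple is too short. *)

Set Implicit Arguments.
Unset Strict Implicit.
Unset Printing Implicit Defensive.

Import GRing.Theory.
Local Open Scope ring_scope.

(** * Functoriality of homology *)

Lemma homology_classP (C : chain_complex) k (h : homology C k) :
  exists z, h = homology_class z.
Proof. by exists (repr h); rewrite /homology_class generic_quotient.reprK. Qed.

Lemma homology_map_id (C : chain_complex) (f : chain_map C C) k :
  f k =1 id -> homology_map f k =1 id.
Proof.
move=> f1 h; have [z ->] := homology_classP h.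
rewrite [LHS]homology_funE; congr homology_class.
exact/val_inj/f1.
Qed.

(** Stated for a chain map [e] agreeing pointwise with the composite, so that
    no composite chain map has to be built. *)
Lemma homology_map_comp (C D E : chain_complex) (e : chain_map C E)
    (g : chain_map D E) (f : chain_map C D) k :
  e k =1 g k \o f k -> homology_map e k =1 homology_map g k \o homology_map f k.
Proof.
move=> egf h; have [z ->] := homology_classP h.
rewrite [LHS]homology_funE /= !homology_funE; congr homology_class.
exact/val_inj/egf.
Qed.

(** * Functoriality of the magnitude complex *)

Lemma MC_map_id (G : graph) k l : @MC_map G G (graph_id G) k l =1 id.
Proof.
pose f : {additive MC G k l -> MC G k l} := @MC_map G G (graph_id G) k l.
apply: (@freeg_additive_eq _ _ f idfun) => x; rewrite /f /= -basis_val.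
by rewrite (MC_map_basis _ (valP x)) map_id.
Qed.

(** The length of [map f s] is squeezed between those of [map g (map f s)] and
    of [s], which are both [l]. *)
Lemma generator_map_inv (G H K : graph) (g : graph_map H K) (f : graph_map G H)
    k l s :
  is_generator k l s -> is_generator k l (map g (map f s)) ->
  is_generator k l (map f s).
Proof.
move=> sP /and3P[_ _ /eqP gfl]; rewrite is_generator_map //.
have /and3P[_ _ /eqP sl] := sP.
move: (tuple_length_map f s) (tuple_length_map g (map f s)).
rewrite sl gfl; case: tuple_length => //= m ml lm.
by apply/eqP; congr Some; lia.
Qed.

Lemma MC_map_comp (G H K : graph) (g : graph_map H K) (f : graph_map G H) k l :
  @MC_map G K (graph_comp g f) k l =1 @MC_map H K g k l \o @MC_map G H f k l.
Proof.
pose e : {additive MC G k l -> MC K k l} := @MC_map G K (graph_comp g f) k l.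
pose gf : {additive MC G k l -> MC K k l} :=
  @MC_map H K g k l \o @MC_map G H f k l.
apply: (@freeg_additive_eq _ _ e gf) => x; rewrite /e /gf /= -basis_val.
have sP := valP x; rewrite !(MC_map_basis _ sP) /= map_comp.
have [fP|fP] := boolP (is_generator k l (map f (val x))).
  by rewrite MC_map_basis.
rewrite (basis0 fP) raddf0 basis0 //.
by apply: contraNN fP; apply: generator_map_inv.
Qed.

Theorem proposition14 :
  @is_functor graph_category bigraded_category MH (@MH_map).
Proof.
split=> [G|G H K g f]; apply: bigraded_map_eq => k l.
  exact/homology_map_id/MC_map_id.
exact/homology_map_comp/MC_map_comp.
Qed.
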